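(* Consider the problem (P3): minimize $\sum_{i=1}^n f_i(y_i)$ over $\vec y=(y_1,\dots,y_n)$ subject to $\sum_{i=1}^k y_i\le\sum_{i=1}^k\alpha_i$ for all $k=1,\dots,n$ and $0\le y_i\le\beta_i$ for all $i=1,\dots,n$, with data satisfying the assumptions in the context. Then Algorithm 1 (described in the context) terminates within $L\le n$ outer iterations, and its output $\vec y$ is an optimal solution of (P3).
   Context: Data and assumptions. $n\ge 1$; $0\le\alpha_i<+\infty$ and $0\le\beta_i\le+\infty$ for $i=1,\dots,n$. (When $\beta_i=+\infty$, the constraint $y_i\le\beta_i$ is void and $[0,\beta_i]$ means $[0,\infty)$.) Each $f_i$ is real-valued, continuously differentiable and strictly convex on $[0,\beta_i]$, with derivative $g_i=f_i'$, which is continuous and strictly increasing. Put $l_i=g_i(0)$ and $h_i=g_i(\beta_i)$ (understood as $\lim_{y\to\infty}g_i(y)$ if $\beta_i=+\infty$). The minimizer $\bar y_i=\arg\min_{0\le y\le\beta_i}f_i(y)$ exists (and is unique). Define $\phi_i(x)=\max\{l_i,\min\{x,h_i\}\}$ and $H_i(x)=g_i^{-1}(\phi_i(x))$, where $g_i^{-1}$ is the inverse function of $g_i$; so $0\le H_i(x)\le\beta_i$. (Only arguments $x\le 0$ are used below; for these $H_i(x)$ is well defined even if $\beta_i=+\infty$.) Write $x^+=\max\{x,0\}$; empty sums are $0$; $\min\emptyset=\infty$. All computations are exact. Algorithm 1. Step 0 (Initialization). Let $d_k=\sum_{i=1}^k\bar y_i-\sum_{i=1}^k\alpha_i$ for $k=1,\dots,n$.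 Define $w_0=0$, $w_1=\min\{k: d_k\ge 0\}$, and $w_{j+1}=\min\{k>w_j: d_k\ge d_{w_j}\}$ for $j\ge1$. If $w_1=\infty$, output $y_i=\bar y_i$ and $\lambda_i=0$ for all $i$ and stop (no outer iterations; $L=0$). Otherwise let $L=\max\{j\ge1: w_j<\infty\}$, set $\lambda_i=0$ for all $i=1,\dots,n$, and $j=L$. Step 1 (Outer loop). While $j>0$: Case 1: if $\sum_{s=w_{j-1}+1}^{w_j}\bigl(H_s(-\sum_{t=j+1}^L\lambda_{w_t})-\alpha_s\bigr)\ge0$, choose $\xi\ge0$ such that $\sum_{s=w_{j-1}+1}^{w_j}\bigl(H_s(-\sum_{t=j+1}^L\lambda_{w_t}-\xi)-\alpha_s\bigr)=0$ (such $\xi$ exists), set $\lambda_{w_j}=\xi$, and set $j\leftarrow j-1$. Case 2: if $\sum_{s=w_{j-1}+1}^{w_j}\bigl(H_s(-\sum_{t=j+1}^L\lambda_{w_t})-\alpha_s\bigr)<0$, find $$r^*=\min\Bigl\{r: j+1\le r\le L,\ \sum_{s=w_{j-1}+1}^{w_r}\Bigl(H_s\bigl(-\textstyle\sum_{t=r+1}^L\lambda_{w_t}\bigr)-\alpha_s\Bigr)\ge0\Bigr\}.$$ If no such $r^*$ exists, set $\lambda_{w_r}=0$ for $r=j,\dots,L$ and $j\leftarrow j-1$. Otherwise choose $\xi\ge0$ such that $\sum_{s=w_{j-1}+1}^{w_{r^*}}\bigl(H_s(-\sum_{t=r^*+1}^L\lambda_{w_t}-\xi)-\alpha_s\bigr)=0$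 (such $\xi$ exists), set $\lambda_{w_{r^*}}=\xi$ and $\lambda_{w_r}=0$ for $j\le r<r^*$, and set $j\leftarrow j-1$. Step 2 (Output). For $i=1,\dots,n$ output $y_i=H_i\bigl(-\sum_{k=i}^n\lambda_k\bigr)$, together with $\eta_i=\bigl(\phi_i(-\sum_{k=i}^n\lambda_k)+\sum_{k=i}^n\lambda_k\bigr)^+$ and $\delta_i=\bigl(-\phi_i(-\sum_{k=i}^n\lambda_k)-\sum_{k=i}^n\lambda_k\bigr)^+$. An outer iteration is one pass through the while loop of Step 1. *)

(* Defs.v *)
From mathcomp Require Import all_boot all_order all_algebra.
From mathcomp Require Import all_classical all_reals all_analysis.

Set Implicit Arguments.
Unset Strict Implicit.
Unset Printing Implicit Defensive.

Import Order.TTheory GRing.Theory Num.Theory.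
Import numFieldNormedType.Exports.

Local Open Scope classical_set_scope.
Local Open Scope ring_scope.

(* Indexing.  The variables y_1, ..., y_n are indexed by 'I_n, so that the
   ordinal i stands for the index i + 1.  The n prefix constraints, and with
   them d_k, lambda_k and the indices w_j, keep their numbers k = 1, ..., n,
   as natural numbers.  Hence the variables number p+1, ..., q are the ordinals
   s with p <= s < q, and lambda_i + ... + lambda_n for the variable of ordinal
   i is the sum over i.+1 <= k < n.+1. *)

Section RealFunctions.
Context {R : realType}.

(* The interval [0, b], which is [0, +oo) when b = +oo. *)
Definition box (b : \bar R) : set R := [set y | 0 <= y /\ (y%:E <= b)%E].

Definition strictly_convex_on (A : set R) (f : R -> R) : Prop :=
  forall (x y t : R), A x -> A y -> x != y -> 0 < t < 1 ->
    f (t * x + (1 - t) * y) < t * f x + (1 - t) * f y.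

(* Difference quotients are taken inside A, so that derivatives at the
   endpoints of an interval are one-sided.  If A is a single point the
   condition is void and the value of df there is unconstrained. *)
Definition is_derivative_on (A : set R) (f df : R -> R) : Prop :=
  forall x, A x ->
    (fun y => (f y - f x) / (y - x)) @ within A (dnbhs x) --> df x.

Definition is_argmin_on (A : set R) (f : R -> R) (x : R) : Prop :=
  A x /\ (forall y, A y -> f x <= f y).

End RealFunctions.

Section Problem.
Context {R : realType} {n : nat}.
Variables (f : 'I_n -> R -> R) (alpha : 'I_n -> R) (beta : 'I_n -> \bar R).

Definition feasible (y : 'I_n -> R) : Prop :=
  (forall k : nat, (1 <= k <= n)%N ->
     \sum_(i < n | (i < k)%N) y i <= \sum_(i < n | (i < k)%N) alpha i)
  /\ (forall i, 0 <= y i /\ ((y i)%:E <= beta i)%E).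

Definition optimal (y : 'I_n -> R) : Prop :=
  feasible y /\
  (forall z, feasible z -> \sum_(i < n) f i (y i) <= \sum_(i < n) f i (z i)).

End Problem.

Section Algorithm.
Context {R : realType} {n : nat}.
Variables (g : 'I_n -> R -> R) (alpha : 'I_n -> R) (beta : 'I_n -> \bar R).
Variable ybar : 'I_n -> R.

Definition gl (i : 'I_n) : R := g i 0.

Definition gh (i : 'I_n) : \bar R :=
  if beta i == +oo%E then lim ((g i y)%:E @[y --> +oo%R])
  else (g i (fine (beta i)))%:E.

(* The extended value is finite whenever gh i is not -oo. *)
Definition phi (i : 'I_n) (x : R) : R :=
  fine (maxe (gl i)%:E (mine x%:E (gh i))).

Definition H (i : 'I_n) (x : R) : R :=
  'pinv_(fun=> 0) (box (beta i)) (g i) (phi i x).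

Definition d (k : nat) : R :=
  \sum_(i < n | (i < k)%N) ybar i - \sum_(i < n | (i < k)%N) alpha i.

(* The least k in {1, ..., n} satisfying P; None is the value infinity. *)
Definition min_index (P : pred nat) : option nat :=
  ohead [seq k <- iota 1 n | P k].

Fixpoint w_opt (j : nat) : option nat :=
  match j with
  | 0 => Some 0%N
  | 1 => min_index (fun k => 0 <= d k)
  | j'.+1 => if w_opt j' is Some m
             then min_index (fun k => (m < k)%N && (d m <= d k))
             else None
  end.

(* Only meaningful for the j with w_j finite. *)
Definition w (j : nat) : nat := odflt 0%N (w_opt j).

Definition is_L (L : nat) : Prop :=
  if w_opt 1 is None then L = 0%N
  else [/\ (1 <= L)%N, w_opt L <> None &
           forall j, (1 <= j)%N -> w_opt j <> None -> (j <= L)%N].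

(* The sum of lambda_(w_t) over r < t <= L. *)
Definition tail (L : nat) (lam : nat -> R) (r : nat) : R :=
  \sum_(r.+1 <= t < L.+1) lam (w t).

(* The sum of H_s(x) - alpha_s over w_a < s <= w_b. *)
Definition excess (a b : nat) (x : R) : R :=
  \sum_(s < n | (w a <= s < w b)%N) (H s x - alpha s).

Definition set_at (lam : nat -> R) (k : nat) (v : R) : nat -> R :=
  fun k' => if k' == k then v else lam k'.

(* Sets lambda_(w_r) to 0 for a <= r < b. *)
Definition reset (lam : nat -> R) (a b : nat) : nat -> R :=
  fun k => if k \in [seq w r | r <- index_iota a b] then 0 else lam k.

(* The test defining r* in Case 2. *)
Definition admissible (L : nat) (lam : nat -> R) (j r : nat) : Prop :=
  (j.+1 <= r <= L)%N /\ 0 <= excess j.-1 r (- tail L lam r).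

(* outer_iteration L lam j lam' : the pass with counter j may turn lam into
   lam'.  It is a relation because the choice of xi need not be unique. *)
Inductive outer_iteration (L : nat) (lam : nat -> R) (j : nat) :
    (nat -> R) -> Prop :=
| Case1 (xi : R) :
    0 <= excess j.-1 j (- tail L lam j) ->
    0 <= xi ->
    excess j.-1 j (- tail L lam j - xi) = 0 ->
    outer_iteration L lam j (set_at lam (w j) xi)
| Case2_none :
    excess j.-1 j (- tail L lam j) < 0 ->
    (forall r, ~ admissible L lam j r) ->
    outer_iteration L lam j (reset lam j L.+1)
| Case2_some (r : nat) (xi : R) :
    excess j.-1 j (- tail L lam j) < 0 ->
    admissible L lam j r ->
    (forall r', admissible L lam j r' -> (r <= r')%N) ->
    0 <= xi ->
    excess j.-1 r (- tail L lam r - xi) = 0 ->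
    outer_iteration L lam j (reset (set_at lam (w r) xi) j r).

(* The sum of lambda_k from the number of the variable i up to n. *)
Definition multiplier (lam : nat -> R) (i : 'I_n) : R :=
  \sum_(i.+1 <= k < n.+1) lam k.

Inductive output : Type :=
| EarlyOutput (y : 'I_n -> R) (lam : nat -> R)
| FinalOutput (y eta delta : 'I_n -> R).

Definition out_y (o : output) : 'I_n -> R :=
  match o with EarlyOutput y _ => y | FinalOutput y _ _ => y end.

Definition step2 (lam : nat -> R) : output :=
  FinalOutput
    (fun i => H i (- multiplier lam i))
    (fun i => Num.max (phi i (- multiplier lam i) + multiplier lam i) 0)
    (fun i => Num.max (- phi i (- multiplier lam i) - multiplier lam i) 0).

Inductive config : Type :=
| Loop (lam : nat -> R) (j : nat)
| Done (o : output).

(* exec L m c : some execution reaches c after exactly m outer iterations. *)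
Inductive exec (L : nat) : nat -> config -> Prop :=
| exec_early :
    w_opt 1 = None -> exec L 0 (Done (EarlyOutput ybar (fun=> 0)))
| exec_init :
    w_opt 1 <> None -> exec L 0 (Loop (fun=> 0) L)
| exec_loop m lam j lam' :
    exec L m (Loop lam j) -> (0 < j)%N -> outer_iteration L lam j lam' ->
    exec L m.+1 (Loop lam' j.-1)
| exec_output m lam :
    exec L m (Loop lam 0) -> exec L m (Done (step2 lam)).

End Algorithm.

(* Main.v *)
Require Import Defs.
From mathcomp Require Import all_boot all_order all_algebra.
From mathcomp Require Import all_classical all_reals all_analysis.
From mathcomp Require Import lra ring zify.
Import Order.TTheory GRing.Theory Num.Theory.
Import numFieldNormedType.Exports.
Local Open Scope classical_set_scope.
Local Open Scope ring_scope.

Set Implicit Arguments.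
Unset Strict Implicit.
Unset Printing Implicit Defensive.

(** The vector y is optimal as soon as there are multipliers lam_k >= 0 on the
    prefix constraints such that each y_i minimizes f_i(y) + (lam_i + ... +
    lam_n) y over [0, beta_i], y is feasible, and lam_k > 0 only where the k-th
    constraint is an equality: then each f_i lies above its tangent at y_i, and
    an Abel summation turns the total of the slopes into a sum of nonnegative
    terms lam_k (alpha_1 + ... + alpha_k - z_1 - ... - z_k)
    [multipliers_optimal].  For x <= 0 the function H_i(x) is exactly the
    minimizer of f_i(y) - x y [H_stationary]; it is monotone, continuous,
    equal to ybar_i at 0 and to 0 for very negative x, so that the output has
    the first property and the numbers xi required by the algorithm exist by
    the intermediate value theorem [excess_root].

    The indices w_1 < ... < w_L are the records of d.  Between two records, and
    after the last one, d stays below its last record; since H_i(x) <= ybar_i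
    for x <= 0, a prefix constraint at a position that is not a record follows
    from the one at the preceding record [prefix_sum_le0].  Hence only the
    multipliers at records matter, and one can work with the blocks of
    variables between consecutive records.

    The loop invariant [kkt] says that the current multipliers solve the
    problem restricted to the blocks after the j-th one.  Both cases of the
    loop body are one operation: take the least r >= j such that the blocks
    j, ..., r, all evaluated at the multipliers beyond r, have nonnegative
    excess, and pool these blocks under the single multiplier xi at w_r that
    makes their excess vanish.  Case 1 is r = j.  Such an r always exists,
    because r = L qualifies: its excess is d(w_L) - d(w_(j-1)) >= 0
    [pool_exists].  Pooling preserves the invariant [kkt_step].  The heart of
    the matter is that, when r > j, the constraint at w_r was already tight
    with a positive multiplier, and that this multiplier can only decrease
    [pool_tight]; so the blocks j + 1, ..., r do not consume less than before,
    which keeps the constraints before w_r satisfied because the pool is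
    balanced, while nothing changes beyond r. *)

(** * Pooling blocks with monotone excess *)

Section Blocks.
(** Block t, for 1 <= t <= L, consumes e t x more than it is allotted when all
    its variables respond to the price - x. *)
Context {R : realDomainType} (e : nat -> R -> R) (L : nat).
Hypothesis e_homo : forall t (x y : R),
  (0 < t <= L)%N -> x <= y -> y <= 0 -> e t x <= e t y.

Definition suffix (l : nat -> R) (r : nat) : R := \sum_(r.+1 <= t < L.+1) l t.

Definition flat (a b : nat) (x : R) : R := \sum_(a.+1 <= t < b.+1) e t x.

Definition cumul (l : nat -> R) (a b : nat) : R :=
  \sum_(a.+1 <= t < b.+1) e t (- suffix l t.-1).

(** The Karush-Kuhn-Tucker conditions for the blocks a + 1, ..., L alone: dual
    feasibility, primal feasibility and complementary slackness. *)
Record kkt (l : nat -> R) (a : nat) : Prop := Kkt {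
  kkt_ge0 : forall r, (a < r <= L)%N -> 0 <= l r;
  kkt_le0 : forall r, (a <= r <= L)%N -> cumul l a r <= 0;
  kkt_eq0 : forall r, (a < r <= L)%N -> 0 < l r -> cumul l a r = 0 }.

Lemma suffixS l r : (r < L)%N -> suffix l r = l r.+1 + suffix l r.+1.
Proof. by move=> rL; rewrite /suffix big_ltn. Qed.

Lemma suffix_ge0 l a r : kkt l a -> (a <= r)%N -> 0 <= suffix l r.
Proof.
move=> K ar; rewrite /suffix big_nat_cond.
apply: sumr_ge0 => t /andP[/andP[rt tL] _].
by apply: (kkt_ge0 K); lia.
Qed.

Lemma flat_cat a b c x : (a <= b <= c)%N ->
  flat a c x = flat a b x + flat b c x.
Proof. by move=> /andP[ab bc]; rewrite /flat (@big_cat_nat _ _ _ b.+1). Qed.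

Lemma cumul_cat l a b c : (a <= b <= c)%N ->
  cumul l a c = cumul l a b + cumul l b c.
Proof. by move=> /andP[ab bc]; rewrite /cumul (@big_cat_nat _ _ _ b.+1). Qed.

Lemma flat_homo a b x y : (b <= L)%N -> x <= y -> y <= 0 ->
  flat a b x <= flat a b y.
Proof.
move=> bL xy y0; rewrite /flat big_nat_cond [leRHS]big_nat_cond.
by apply: ler_sum => t /andP[tab _]; apply: e_homo => //; lia.
Qed.

Lemma eq_cumul l l' a b :
    (forall t, (a <= t < b)%N -> suffix l t = suffix l' t) ->
  cumul l a b = cumul l' a b.
Proof.
move=> h; rewrite /cumul; apply: eq_big_nat => -[|t] // tab.
by rewrite /= h //; lia.
Qed.

Lemma cumul_flat l a b x : (forall t, (a <= t < b)%N -> suffix l t = x) ->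
  cumul l a b = flat a b (- x).
Proof.
move=> h; rewrite /cumul /flat; apply: eq_big_nat => -[|t] // tab.
by rewrite /= h //; lia.
Qed.

Lemma cumul_le_flat l a b x : (b <= L)%N -> x <= 0 ->
    (forall t, (a <= t < b)%N -> - suffix l t <= x) ->
  cumul l a b <= flat a b x.
Proof.
move=> bL x0 h; rewrite /cumul /flat big_nat_cond [leRHS]big_nat_cond.
apply: ler_sum => -[|t] // /andP[tab _].
by apply: e_homo => //=; first lia; apply: h; lia.
Qed.

Lemma suffix_const l a b : (b <= L)%N ->
    (forall t, (a < t <= b)%N -> l t = 0) ->
  forall t, (a <= t <= b)%N -> suffix l t = suffix l b.
Proof.
move=> bL h t /andP[at_ tb].
rewrite /suffix (@big_cat_nat _ _ _ b.+1) //= big_nat_cond big1 ?add0r //.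
by move=> i /andP[/andP[ti ib] _]; apply: h; lia.
Qed.

(** Used with l the multipliers: between the position p found here and b all
    prices coincide. *)
Lemma last_tight (l : nat -> R) a b : (a < b)%N -> exists p,
  [/\ (a <= p < b)%N, p = a \/ l p != 0
    & forall t, (p < t < b)%N -> l t = 0].
Proof.
elim: b => // b IH ab.
have [l0|l0] := eqVneq (l b) 0; last first.
  by exists b; split; [lia|right|move=> t; lia].
have [<-|nab] := eqVneq a b; first by exists a; split; [lia|left|move=> t; lia].
have [|p [h1 h2 h3]] := IH; first lia.
exists p; split=> //; first lia.
move=> t tp; have [->//|tb] := eqVneq t b.
by apply: h3; lia.
Qed.

(** Let p be the last position before r that carries a multiplier, or j.  The
    excess from p to r at the price in force there is cumul l j r <= 0, and the
    excess from j to p is negative by minimality of r; so the pool j, ..., r has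
    negative excess at that price, suffix l r + l r.  As its excess at the price
    suffix l r is nonnegative, l r cannot be 0. *)
Lemma pool_tight l j r :
    kkt l j -> (0 < j < r)%N -> (r <= L)%N ->
    0 <= flat j.-1 r (- suffix l r) ->
    (forall r', (j <= r' < r)%N -> flat j.-1 r' (- suffix l r') < 0) ->
  [/\ 0 < l r, cumul l j r = 0 & flat j.-1 r (- suffix l r - l r) < 0].
Proof.
move=> K jr rL F Fmin.
have [|p [pr tight slack]] := @last_tight l j r; first by lia.
have sc t : (p <= t < r)%N -> suffix l t = suffix l r + l r.
  have rE : r = r.-1.+1 by lia.
  move=> tpr; rewrite (@suffix_const l p r.-1) //; [|lia| |lia].
    by rewrite suffixS 1?addrC -?rE //; lia.
  by move=> i ip; apply: slack; lia.
have cp0 : cumul l j p = 0.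
  have [->|npj] := eqVneq p j; first by rewrite /cumul big_geq.
  case: tight => [/eqP|lp]; first by rewrite (negPf npj).
  apply: (kkt_eq0 K); first by lia.
  by rewrite lt_def lp (kkt_ge0 K) //; lia.
have neg : flat j.-1 r (- suffix l r - l r) < 0.
  rewrite -opprD -(sc p); last by lia.
  rewrite (@flat_cat _ p); last by lia.
  have -> : flat p r (- suffix l p) = cumul l j r.
    rewrite (@cumul_cat _ _ p); last by lia.
    rewrite cp0 add0r (@cumul_flat l p r (suffix l p)) // => t tpr.
    by rewrite (sc t) // (sc p) //; lia.
  have := Fmin p; have := kkt_le0 K (r := r).
  by move=> /(_ ltac:(lia)) + /(_ ltac:(lia)); lra.
have lr : 0 < l r.
  have := kkt_ge0 K (r := r); rewrite le_eqVlt.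
  move=> /(_ ltac:(lia)) /orP[/eqP l0|//].
  by move: neg; rewrite -l0 subr0 ltNge F.
by split=> //; apply: (kkt_eq0 K) => //; lia.
Qed.

(** Up to r the blocks now face a common price, which is at most each of the
    former ones; hence the blocks between an intermediate r' >= j and r consume
    no less than before, when they had excess - cumul l j r' >= 0.  The pool
    being balanced, its first part up to r' keeps an excess <= 0.  Beyond r the
    cumulated excess is unchanged because it vanishes at r both before and
    after. *)
Lemma kkt_step l l' j r xi :
    kkt l j -> (0 < j <= r)%N -> (r <= L)%N ->
    0 <= flat j.-1 r (- suffix l r) ->
    (forall r', (j <= r' < r)%N -> flat j.-1 r' (- suffix l r') < 0) ->
    0 <= xi -> flat j.-1 r (- suffix l r - xi) = 0 ->
    (forall t, (r < t <= L)%N -> l' t = l t) -> l' r = xi ->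
    (forall t, (j <= t < r)%N -> l' t = 0) ->
  kkt l' j.-1.
Proof.
move=> K jr rL F Fmin xi0 Fxi l'l l'r l'0.
have Shi t : (r <= t)%N -> suffix l' t = suffix l t.
  by move=> rt; apply: eq_big_nat => i it; apply: l'l; lia.
have Slo t : (j.-1 <= t < r)%N -> suffix l' t = suffix l r + xi.
  have rE : r = r.-1.+1 by lia.
  move=> tr; rewrite (@suffix_const l' j.-1 r.-1) //; [|lia| |lia].
    by rewrite suffixS -?rE ?l'r ?Shi 1?addrC //; lia.
  by move=> i ij; apply: l'0; lia.
have s0 : 0 <= suffix l r by apply: (suffix_ge0 K); lia.
have c'r : cumul l' j.-1 r = 0.
  by rewrite (@cumul_flat _ _ _ (suffix l r + xi)) // opprD.
have [cr Sle] : cumul l j r = 0 /\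
    forall t, (j <= t < r)%N -> suffix l r + xi <= suffix l t.
  have [->|njr] := eqVneq j r.
    by split; [rewrite /cumul big_geq|move=> t; lia].
  have [|l0 c0 neg] := pool_tight K _ rL F Fmin; first by lia.
  split=> // t tjr.
  have xil : xi < l r.
    rewrite ltNge; apply/negP => lxi.
    have := @flat_homo j.-1 r (- suffix l r - xi) (- suffix l r - l r) rL.
    by rewrite Fxi; have := neg; lra.
  have : suffix l r.-1 <= suffix l t.
    rewrite [leRHS](@big_cat_nat _ _ _ r.-1.+1) //=; try lia.
    rewrite lerDr big_nat_cond; apply: sumr_ge0 => i ii.
    by apply: (kkt_ge0 K); lia.
  have rE : r = r.-1.+1 by lia.
  by rewrite suffixS -?rE; [lra|lia].
have chi r' : (r <= r' <= L)%N -> cumul l' j.-1 r' = cumul l j r'.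
  move=> rr'; rewrite (@cumul_cat _ _ r); last by lia.
  rewrite [RHS](@cumul_cat _ _ r); last by lia.
  by rewrite c'r cr (@eq_cumul l' l) // => t tr; apply: Shi; lia.
split.
- move=> t tL; have [tr|rt|->] := ltngtP t r; last by rewrite l'r.
    by rewrite l'0 //; lia.
  by rewrite l'l ?(kkt_ge0 K) //; lia.
- move=> r' r'L; have [rr'|r'r] := leqP r r'.
    by rewrite chi; [apply: (kkt_le0 K)|]; lia.
  have [->|nj] := eqVneq r' j.-1; first by rewrite /cumul big_geq.
  have := c'r; rewrite (@cumul_cat _ _ r'); last by lia.
  rewrite (@cumul_flat l' r' r (suffix l r + xi)); last first.
    by move=> t tr; apply: Slo; lia.
  have : cumul l r' r <= flat r' r (- (suffix l r + xi)).
    apply: cumul_le_flat => //; first by lra.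
    by move=> t tr; rewrite lerN2; apply: Sle; lia.
  have := cr; rewrite (@cumul_cat _ _ r'); last by lia.
  by have := kkt_le0 K (r := r') => /(_ ltac:(lia)); lra.
- move=> r' r'L; have [rr'|r'r|<-//] := ltngtP r r'; last first.
    by rewrite l'0 ?ltxx //; lia.
  by rewrite l'l ?chi; [apply: (kkt_eq0 K)| |]; lia.
Qed.
End Blocks.

(** * Tangents of a strictly convex function on a box *)

Section OneVariable.
Context {R : realType}.
Implicit Types (b : \bar R) (f g : R -> R) (x y z : R).

Lemma box_le b y z : 0 <= y -> y <= z -> box b z -> box b y.
Proof.
by move=> y0 yz [_ zb]; split=> //; apply: le_trans zb; rewrite lee_fin.
Qed.

Lemma box_segment b x z (t : R) : box b x -> box b z -> 0 <= t <= 1 ->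
  box b (x + t * (z - x)).
Proof.
move=> bx bz /andP[t0 t1]; have [x0 _] := bx; have [z0 _] := bz.
by have [xz|zx] := leP x z; [apply: box_le bz|apply: box_le bx]; nra.
Qed.

(** Approaching x along the segment towards z stays inside the box, so this
    also covers the one-sided derivatives at the end points. *)
Lemma cvg_slope b f g x z :
    is_derivative_on (box b) f g -> box b x -> box b z -> z != x ->
  (f (x + t * (z - x)) - f x) / t @[t --> 0^'+] --> g x * (z - x).
Proof.
move=> hd bx bz zx.
have zx0 : z - x != 0 by rewrite subr_eq0.
have cin : x + t * (z - x) @[t --> 0^'+] --> within (box b) (dnbhs x).
  move=> P /= Px.
  have cx : x + t * (z - x) @[t --> (0 : R)] --> x.
    rewrite -[X in _ --> X]addr0 -[X in _ --> _ + X](mul0r (z - x)).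
    by apply: cvgD; [exact: cvg_cst|apply: cvgM; [exact: cvg_id|exact: cvg_cst]].
  have := cx _ Px => /= Px'.
  rewrite /at_right /=; near_simpl.
  near=> t.
  have t0 : 0 < t by near: t; exact: nbhs_right_gt.
  have t1 : t < 1 by near: t; exact: nbhs_right_lt.
  have : x + t * (z - x) != x ->
      box b (x + t * (z - x)) -> P (x + t * (z - x)).
    by near: t; apply: cvg_within; exact: Px'.
  apply; last by apply: box_segment => //; lra.
  by rewrite -subr_eq0 addrC addKr mulf_neq0 // gt_eqF.
have c := cvg_comp _ _ cin (hd x bx).
apply: cvg_trans (cvgM c (cvg_cst (z - x))); apply: near_eq_cvg; near=> t.
have t0 : t != 0 by rewrite gt_eqF //; near: t; exact: nbhs_right_gt.
rewrite /= -[x + t * (z - x) - x]addrAC subrr add0r.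
by field; rewrite t0.
Unshelve. all: by end_near. Qed.

(** The variational inequality that characterizes the minimizer y over the box
    of the function with derivative g y - x. *)
Definition stationary b g x y :=
  box b y /\ forall z, box b z -> 0 <= (g y - x) * (z - y).

Section Gradient.
Variables (b : \bar R) (f g : R -> R).
Hypotheses (f'E : is_derivative_on (box b) f g)
  (f_convex : strictly_convex_on (box b) f).

Lemma tangent_le x z : box b x -> box b z -> g x * (z - x) <= f z - f x.
Proof.
move=> bx bz; have [->|zx] := eqVneq z x; first by rewrite !subrr mulr0.
apply: (cvgr_to_le (cvg_slope f'E bx bz zx)); near=> t.
have t0 : 0 < t by near: t; exact: nbhs_right_gt.
have t1 : t < 1 by near: t; exact: nbhs_right_lt.
have := @f_convex z x t bz bx zx; rewrite t0 t1 => /(_ isT).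
have -> : t * z + (1 - t) * x = x + t * (z - x) by ring.
by rewrite ler_pdivrMr // => ?; lra.
Unshelve. all: by end_near. Qed.

(** Strictness comes from the midpoint m of x and z: f lies strictly below the
    chord at m and weakly above the tangent there. *)
Lemma tangent_lt x z : box b x -> box b z -> z != x ->
  g x * (z - x) < f z - f x.
Proof.
move=> bx bz zx; pose m := x + 2^-1 * (z - x).
have bm : box b m by apply: box_segment => //; lra.
have := tangent_le bx bm.
have := @f_convex z x 2^-1 bz bx zx => /(_ ltac:(lra)).
have -> : 2^-1 * z + (1 - 2^-1) * x = m by rewrite /m; field.
have -> : m - x = 2^-1 * (z - x) by rewrite /m addrC addKr.
rewrite mulrCA; lra.
Qed.

Lemma derivative_lt x y : box b x -> box b y -> x < y -> g x < g y.
Proof.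
move=> bx by_ xy.
have h1 := tangent_lt bx by_ (negbT (gt_eqF xy)).
have h2 := tangent_lt by_ bx (negbT (lt_eqF xy)).
rewrite -(ltr_pM2r (x := y - x)) ?subr_gt0 //; lra.
Qed.

Lemma argmin_stationary y : is_argmin_on (box b) f y -> stationary b g 0 y.
Proof.
move=> [by_ ymin]; split=> // z bz; rewrite subr0.
have [->|zy] := eqVneq z y; first by rewrite subrr mulr0.
apply: (cvgr_to_ge (cvg_slope f'E by_ bz zy)); near=> t.
have t0 : 0 < t by near: t; exact: nbhs_right_gt.
have t1 : t < 1 by near: t; exact: nbhs_right_lt.
apply: divr_ge0; last exact: ltW.
rewrite subr_ge0; apply: ymin.
by apply: box_segment => //; rewrite !ltW.
Unshelve. all: by end_near. Qed.

Lemma stationary_tangent x y z : stationary b g x y -> box b z ->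
  x * (z - y) <= f z - f y.
Proof.
move=> [by_ st] bz; have := tangent_le by_ bz.
by have := st z bz; lra.
Qed.

End Gradient.

(** * The response of one variable to a price *)

Section Response.
Variables (b : \bar R) (g : R -> R).
Hypothesis g_lt : forall x y, box b x -> box b y -> x < y -> g x < g y.

Lemma derivative_inj : {in box b &, injective g}.
Proof.
move=> x y; rewrite !inE => bx by_ gxy.
have [xy|yx|//] := ltgtP x y.
  by have := g_lt bx by_ xy; rewrite gxy ltxx.
by have := g_lt by_ bx yx; rewrite gxy ltxx.
Qed.

Lemma stationary_le x x' y y' : stationary b g x y -> stationary b g x' y' ->
  x <= x' -> y <= y'.
Proof.
move=> [by_ st] [by' st'] xx'; rewrite leNgt; apply/negP => yy'.
have := g_lt by' by_ yy'; have := st y' by'; have := st' y by_; nra.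
Qed.

Lemma stationary_uniq x y y' : stationary b g x y -> stationary b g x y' ->
  y = y'.
Proof.
by move=> s s'; apply/le_anti/andP; split; apply: (@stationary_le x x).
Qed.

Lemma stationary_self y : box b y -> stationary b g (g y) y.
Proof. by move=> by_; split=> // z _; rewrite subrr mul0r. Qed.

Lemma stationary_origin x : (0 <= b)%E -> x <= g 0 -> stationary b g x 0.
Proof.
move=> b0 xg; split; first by [].
by move=> z [z0 _]; rewrite subr0 mulr_ge0 // subr_ge0.
Qed.

Lemma derivative_le y z : box b y -> box b z -> y <= z -> g y <= g z.
Proof.
move=> by_ bz; rewrite le_eqVlt => /orP[/eqP->//|yz].
by apply/ltW/g_lt.
Qed.

(** A monotone function whose values fill an interval is continuous: each y in
    the box below h 0 is the value of h at g y.  Composing with min extends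
    h continuously by a constant beyond 0, the only place where its values are
    not controlled. *)
Lemma response_continuous (h : R -> R) :
    (forall x, x <= 0 -> stationary b g x (h x)) ->
  continuous (fun x => h (Num.min x 0)).
Proof.
move=> hst x0 /=; apply/cvgrPdist_le => e e0.
set m := Num.min x0 0; have m0 : m <= 0 by rewrite /m ge_min lexx orbT.
have min0 x : Num.min x 0 <= 0 by rewrite ge_min lexx orbT.
have hbox x : x <= 0 -> box b (h x) by move=> /hst[].
have g_neg y : box b y -> y < h 0 -> g y < 0.
  move=> by_ yh; apply: lt_le_trans (g_lt by_ (hbox 0 (lexx 0)) yh) _.
  have [_ /(_ y by_)] := hst 0 (lexx 0); rewrite subr0.
  by rewrite nmulr_lge0 // subr_lt0.
have h_of y : box b y -> g y <= 0 -> h (g y) = y.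
  by move=> by_ gy0; apply: stationary_uniq (hst _ gy0) (stationary_self by_).
have h_le x y : x <= y -> y <= 0 -> h x <= h y.
  by move=> xy y0; apply: stationary_le (hst _ (le_trans xy y0)) (hst _ y0) xy.
have [hm0 _] := hbox m m0.
(* If h m + e < h 0, it is the value of h at a point beyond x0, namely
   g (h m + e), and monotonicity bounds h up to that point. *)
have up : \forall x \near x0, h (Num.min x 0) <= h m + e.
  have [le0|lt0] := leP (h 0) (h m + e).
    by near=> x; apply: le_trans le0; apply: h_le.
  have by1 : box b (h m + e) by apply: box_le (hbox 0 (lexx 0)) => //; lra.
  have g0 := g_neg _ by1 lt0.
  have x01 : x0 < g (h m + e).
    rewrite ltNge; apply/negP => gx.
    have : h (g (h m + e)) <= h m.
      by apply: h_le => //; rewrite le_min gx; exact: ltW.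
    by rewrite (h_of _ by1 (ltW g0)); lra.
  near=> x.
  rewrite -(h_of _ by1 (ltW g0)); apply: h_le; last exact: ltW.
  by rewrite ge_min ltW //; near: x; exact: lt_nbhsl.
have lo : \forall x \near x0, h m - e <= h (Num.min x 0).
  have [le0|lt0] := leP (h m - e) 0.
    by near=> x; apply: le_trans le0 _; case: (hbox _ (min0 x)).
  have by1 : box b (h m - e) by apply: box_le (hbox m m0) => //; lra.
  have g0 : g (h m - e) < 0.
    by apply: g_neg => //; have := h_le _ _ m0 (lexx 0); lra.
  have x1m : g (h m - e) < m.
    rewrite ltNge; apply/negP => gx.
    have : h m <= h (g (h m - e)) by apply: h_le => //; exact: ltW.
    by rewrite (h_of _ by1 (ltW g0)); lra.
  near=> x.
  rewrite -(h_of _ by1 (ltW g0)); apply: h_le => //.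
  rewrite le_min (ltW g0) andbT ltW //; near: x; apply: lt_nbhsr.
  by apply: lt_le_trans x1m _; rewrite ge_min lexx.
near=> x; rewrite ler_distlC; apply/andP; split; near: x => //.
Unshelve. all: by end_near. Qed.
End Response.

End OneVariable.

Section IndexedResponse.
Context {R : realType} {n : nat}.
Variables (g : 'I_n -> R -> R) (beta : 'I_n -> \bar R) (i : 'I_n) (ybar : R).
Hypotheses (beta_ge0 : (0 <= beta i)%E)
  (g_cont : {within box (beta i), continuous (g i)})
  (g_lt : forall x y, box (beta i) x -> box (beta i) y -> x < y ->
     g i x < g i y)
  (ybar_st : stationary (beta i) (g i) 0 ybar).

(** On an unbounded box g i is only known to be monotone on the nonnegative
    reals, hence the truncated function u in the proof. *)
Lemma gh_ge y : box (beta i) y -> ((g i y)%:E <= gh g beta i)%E.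
Proof.
move=> by_; rewrite /gh; case: eqP => [boo|bfin]; last first.
  have bE : beta i = (fine (beta i))%:E by case: (beta i) bfin beta_ge0.
  rewrite lee_fin; case: by_ => y0 yb.
  apply: (derivative_le g_lt) => //; rewrite -?lee_fin -?bE //.
  by split=> //; rewrite -?lee_fin -?bE.
have box0 z : 0 <= z -> box (beta i) z.
  by move=> z0; split=> //; rewrite boo leey.
pose u z := (g i (Num.max 0 z))%:E.
have cu : cvg (u z @[z --> +oo%R]).
  apply: nondecreasing_is_cvge => p q pq; rewrite lee_fin.
  apply: (derivative_le g_lt) => //.
  - by apply: box0; rewrite le_max lexx.
  - by apply: box0; rewrite le_max lexx.
  - by rewrite ge_max !le_max lexx pq orbT.
have eu : \forall z \near +oo%R, u z = (g i z)%:E.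
  near=> z; rewrite /u max_r //.
have <- : lim (u z @[z --> +oo%R]) = lim ((g i z)%:E @[z --> +oo%R]).
  by congr (lim _); apply/seteqP; split; apply: near_eq_cvg => //;
    near do apply/esym.
apply: lime_ge => //; near=> z; rewrite lee_fin.
have [y0 _] := by_.
have yz : y <= z by near: z; apply: nbhs_pinfty_ge; rewrite num_real.
by apply: (derivative_le g_lt) => //; [apply: box0|];
  rewrite le_max ?lexx ?yz ?orbT.
Unshelve. all: by end_near. Qed.

Lemma H_pinv x y : box (beta i) y -> phi g beta i x = g i y ->
  H g beta i x = y.
Proof.
move=> by_ pE; rewrite /H pE pinvKV ?inE //.
by move=> ? ?; apply: (derivative_inj g_lt).
Qed.

(** For x between g 0 and g ybar, the intermediate value theorem makes x a
    value of g.  If x exceeds g ybar then g ybar < 0, so that ybar is the right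
    end point of the box, where phi truncates x to g ybar. *)
Lemma H_stationary x : x <= 0 ->
  stationary (beta i) (g i) x (H g beta i x).
Proof.
move=> x0.
have b0 : box (beta i) 0 by [].
have [xg|gx] := leP x (g i 0).
  rewrite (H_pinv (y := 0)) //; first exact: stationary_origin.
  by rewrite /phi /gl max_l // ge_min lee_fin xg.
have [by_ vi] := ybar_st; have [y0 yb] := by_.
have [xgy|gyx] := leP x (g i ybar).
  have [||y /[!in_itv]/= /andP[y0' yy] gy] := @IVT R (g i) 0 ybar x y0.
  - apply: continuous_subspaceW g_cont => z /=.
    by rewrite in_itv /= => /andP[z0 zy]; apply: box_le by_.
  - by rewrite ge_min le_max (ltW gx) xgy orbT.
  have byy : box (beta i) y by apply: box_le by_.
  rewrite (H_pinv (y := y)) //; first by rewrite -gy; apply: stationary_self.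
  rewrite /phi min_l; last by apply: le_trans (gh_ge by_); rewrite lee_fin.
  by rewrite max_r // lee_fin ltW.
have ymax z : box (beta i) z -> z <= ybar.
  by move=> /vi; rewrite subr0 nmulr_rge0 ?subr_le0 //; apply: lt_le_trans x0.
have ghE : gh g beta i = (g i ybar)%:E.
  have [boo|bfin] := eqVneq (beta i) +oo%E.
    have : box (beta i) (ybar + 1) by split; [exact: addr_ge0|rewrite boo leey].
    by move=> /ymax; rewrite gerDl ler10.
  have bE : beta i = (fine (beta i))%:E by case: (beta i) bfin beta_ge0.
  rewrite /gh (negPf bfin); congr (g i _)%:E.
  apply/le_anti; rewrite ymax /=; last first.
    by split; rewrite -?lee_fin -?bE.
  by rewrite -lee_fin -bE.
rewrite (H_pinv (y := ybar)) //.
  split=> // z bz; have := ymax z bz; nra.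
rewrite /phi ghE min_r; last by rewrite lee_fin ltW.
by rewrite max_r // lee_fin; apply: (derivative_le g_lt).
Qed.

End IndexedResponse.

(** * Records of the unconstrained prefix sums *)

Section Ladder.
Context {R : realType} {n : nat}.
Variables alpha ybar : 'I_n -> R.
Local Notation d := (d alpha ybar).
Local Notation w_opt := (w_opt alpha ybar).
Local Notation w := (w alpha ybar).

Lemma ohead_filter_iotaP (P : pred nat) a m :
  if ohead [seq k <- iota a m | P k] is Some k
  then [/\ (a <= k < a + m)%N, P k & forall i, (a <= i < k)%N -> ~~ P i]
  else forall i, (a <= i < a + m)%N -> ~~ P i.
Proof.
elim: m a => [|m IH] a /=; first by move=> i; lia.
case: ifP => /= Pa; first by split=> // [|i]; lia.
have low i : (a <= i)%N -> (a.+1 <= i)%N \/ ~~ P i.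
  by rewrite leq_eqVlt => /orP[/eqP <-|]; [right; rewrite Pa|left].
case: ohead (IH a.+1) => [k [ka Pk kmin]|kmin].
  split=> //; first by lia.
  by move=> i ik; case: (low i); [lia| move=> ai; apply: kmin; lia|].
by move=> i ik; case: (low i); [lia| move=> ai; apply: kmin; lia|].
Qed.

Definition next_record (m : nat) : option nat :=
  @min_index n (fun k => (m < k)%N && (d m <= d k)).

Lemma next_record_some m k : next_record m = Some k ->
  [/\ (m < k <= n)%N, d m <= d k
    & forall i, (m < i < k)%N -> d i < d m].
Proof.
rewrite /next_record /min_index => E.
have := ohead_filter_iotaP (fun k => (m < k)%N && (d m <= d k)) 1 n.
rewrite E => -[kn /andP[mk dk] kmin]; split=> //; first by lia.
move=> i ik; have := kmin i; rewrite (_ : (m < i)%N) /=; last by lia.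
by rewrite -ltNge; apply; lia.
Qed.

Lemma next_record_none m : next_record m = None ->
  forall i, (m < i <= n)%N -> d i < d m.
Proof.
rewrite /next_record /min_index => E.
have := ohead_filter_iotaP (fun k => (m < k)%N && (d m <= d k)) 1 n.
rewrite E => kmin i ik; have := kmin i; rewrite (_ : (m < i)%N) /=; last by lia.
by rewrite -ltNge; apply; lia.
Qed.

Lemma d0 : d 0 = 0.
Proof. by rewrite /Defs.d !big_pred0_eq subrr. Qed.

(** Because d 0 = 0, the first record obeys the same recursion as the others,
    with w_0 = 0. *)
Lemma w_optS j : w_opt j.+1 = obind next_record (w_opt j).
Proof.
case: j => [|j] //=; rewrite /next_record /min_index; congr ohead.
by apply: eq_in_filter => k; rewrite mem_iota d0 => /andP[-> _].
Qed.

Lemma w_opt_bound j m : w_opt j = Some m -> (j <= m <= n)%N.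
Proof.
elim: j m => [|j IH] m; first by case=> <-.
rewrite w_optS; case: (w_opt j) IH => //= p /(_ p erefl) jp /next_record_some[].
by lia.
Qed.

Lemma w_opt_prefix i j : (i <= j)%N -> w_opt j <> None -> w_opt i <> None.
Proof.
move=> /subnKC <-; elim: (j - i)%N => [|k IH]; first by rewrite addn0.
by rewrite addnS w_optS => h; apply: IH => e; rewrite e in h.
Qed.

Lemma last_record : exists2 L, is_L alpha ybar L & (L <= n)%N.
Proof.
have bound j : w_opt j -> (j <= n)%N.
  by case E: (w_opt j) => [m|//] _; have := w_opt_bound E; lia.
have ex0 : exists j, w_opt j : bool by exists 0%N.
case: (ex_maxnP ex0 bound) => L wL Lmax; exists L; last exact: bound.
rewrite /is_L; case E : (w_opt 1) => [m|].
  split=> [||j _ wj]; [|by case: (w_opt L) wL|].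
    by apply: Lmax; rewrite E.
  by apply: Lmax; case: (w_opt j) wj.
case: L wL {Lmax} => // L wL.
have := @w_opt_prefix 1 L.+1 isT; rewrite E; case: (w_opt L.+1) wL => // m _ h.
by case: (h _ erefl).
Qed.

Section Records.
Variable L : nat.
Hypothesis isL : is_L alpha ybar L.

Lemma w_opt_le j : (j <= L)%N -> w_opt j = Some (w j).
Proof.
move=> jL; rewrite /Defs.w; suff : w_opt j <> None by case: (w_opt j).
apply: (w_opt_prefix jL).
by move: isL; rewrite /is_L; case: (Defs.w_opt _ _ 1) => [m []|->].
Qed.

Lemma w_next j : (j < L)%N -> next_record (w j) = Some (w j.+1).
Proof. by move=> jL; rewrite -w_opt_le // w_optS w_opt_le // ltnW. Qed.

Lemma w_last : next_record (w L) = None.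
Proof.
have -> : next_record (w L) = w_opt L.+1 by rewrite w_optS w_opt_le.
move: isL; rewrite /is_L; case E : (Defs.w_opt _ _ 1) => [m|]; last by move->.
case=> _ _ /(_ L.+1 isT); rewrite ltnn; case: (w_opt L.+1) => // k.
by move=> /(_ ltac:(discriminate)).
Qed.

Lemma w_lt j : (j < L)%N -> (w j < w j.+1)%N.
Proof. by move=> /w_next/next_record_some[/andP[]]. Qed.

Lemma w_bound j : (j <= L)%N -> (w j <= n)%N.
Proof. by move=> /w_opt_le/w_opt_bound/andP[]. Qed.

Lemma w_mono i j : (i <= j)%N -> (j <= L)%N -> (w i <= w j)%N.
Proof.
move=> /subnKC <-; elim: (j - i)%N => [|k IH]; first by rewrite addn0.
by rewrite addnS => ikL; apply: leq_trans (IH (ltnW ikL)) (ltnW (w_lt ikL)).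
Qed.

Lemma w_smono i j : (i < j)%N -> (j <= L)%N -> (w i < w j)%N.
Proof.
move=> ij jL; apply: leq_trans (w_mono ij jL); apply: w_lt.
exact: leq_trans jL.
Qed.

Lemma w_inj i j : (i <= L)%N -> (j <= L)%N -> w i = w j -> i = j.
Proof.
move=> iL jL wij; have [ij|ji|//] := ltngtP i j.
  by have := w_smono ij jL; rewrite wij ltnn.
by have := w_smono ji iL; rewrite wij ltnn.
Qed.

Lemma d_mono i j : (i <= j)%N -> (j <= L)%N -> d (w i) <= d (w j).
Proof.
move=> /subnKC <-; elim: (j - i)%N => [|k IH]; first by rewrite addn0.
rewrite addnS => ikL; apply: le_trans (IH (ltnW ikL)) _.
by have /next_record_some[] := w_next ikL.
Qed.

(** The value of d at k is dominated by its value at the last record up to k,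
    w_r; the final clause says that w_r is this last record. *)
Lemma last_record_before k : (k <= n)%N -> exists r,
  [/\ (r <= L)%N, (w r <= k)%N, d k <= d (w r)
    & forall t, (r < t <= L)%N -> (k < w t)%N].
Proof.
move=> kn.
have ex0 : exists j, (j <= L)%N && (w j <= k)%N by exists 0%N.
have bound j : (j <= L)%N && (w j <= k)%N -> (j <= L)%N by case/andP.
case: (ex_maxnP ex0 bound) => r /andP[rL wr] rmax; exists r; split=> //.
- have [<-//|nwk] := eqVneq (w r) k.
  have wk : (w r < k)%N by rewrite ltn_neqAle nwk.
  have [rE|nr] := eqVneq r L.
    by apply: ltW; apply: next_record_none; [rewrite rE w_last|rewrite wk].
  have rL' : (r < L)%N by rewrite ltn_neqAle nr.
  have /next_record_some[_ _ h] := w_next rL'.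
  apply/ltW/h; rewrite wk ltnNge; apply/negP => wk'.
  by have := rmax r.+1; rewrite rL' wk' => /(_ isT); rewrite ltnn.
- move=> t /andP[rt tL]; rewrite ltnNge; apply/negP => wt.
  by have := rmax t; rewrite tL wt => /(_ isT); rewrite leqNgt rt.
Qed.
End Records.
End Ladder.

(** * Multipliers certify optimality *)

Section Sufficiency.
Context {R : realType} {n : nat}.

(** Abel summation. *)
Lemma sum_multiplier (lam : nat -> R) (v : 'I_n -> R) :
  \sum_(i < n) multiplier lam i * v i =
  \sum_(1 <= k < n.+1) lam k * \sum_(i < n | (i < k)%N) v i.
Proof.
under eq_bigr => i _.
  rewrite /multiplier (@big_nat_widenl _ _ _ _ 1%N) //= big_mkcond /= mulr_suml.
  over.
rewrite exchange_big /=; apply: eq_bigr => k _.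
rewrite mulr_sumr [RHS]big_mkcond /=; apply: eq_bigr => i _.
by case: ifP => //; rewrite mul0r.
Qed.

Variables (f g : 'I_n -> R -> R) (alpha : 'I_n -> R) (beta : 'I_n -> \bar R).
Hypotheses (f'E : forall i, is_derivative_on (box (beta i)) (f i) (g i))
  (f_convex : forall i, strictly_convex_on (box (beta i)) (f i)).

(** Each tangent inequality bounds f_i (z_i) - f_i (y_i) below by the i-th
    multiplier times y_i - z_i; the sum is regrouped by constraints. *)
Lemma multipliers_optimal (lam : nat -> R) (y : 'I_n -> R) :
    feasible alpha beta y ->
    (forall i, stationary (beta i) (g i) (- multiplier lam i) (y i)) ->
    (forall k, 0 <= lam k) ->
    (forall k, (1 <= k <= n)%N -> 0 < lam k ->
       \sum_(i < n | (i < k)%N) y i = \sum_(i < n | (i < k)%N) alpha i) ->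
  optimal f alpha beta y.
Proof.
move=> yfeas yst lam0 slack; split=> // z [zcap zbox]; rewrite -subr_ge0 -sumrB.
apply: (@le_trans _ _ (\sum_(i < n) multiplier lam i * (y i - z i))); last first.
  apply: ler_sum => i _.
  have := stationary_tangent (@f'E i) (@f_convex i) (yst i) (zbox i).
  by rewrite mulNr -mulrN opprB.
rewrite sum_multiplier big_nat_cond; apply: sumr_ge0 => k /andP[kn _].
have [l0|_] := eqVneq (lam k) 0; first by rewrite l0 mul0r.
have [l0|l0] := ltP 0 (lam k); last first.
  by rewrite (@le_anti _ _ (lam k) 0) ?l0 ?lam0 // mul0r.
by rewrite mulr_ge0 // sumrB slack // subr_ge0 zcap.
Qed.
End Sufficiency.

(** * Correctness of the algorithm *)

Section RangeSum.
Context {R : realType} {n : nat}.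

Lemma range_sum_cat (v : 'I_n -> R) a b c : (a <= b <= c)%N ->
  \sum_(s < n | (a <= s < c)%N) v s =
  \sum_(s < n | (a <= s < b)%N) v s + \sum_(s < n | (b <= s < c)%N) v s.
Proof.
move=> abc; rewrite (bigID (fun s : 'I_n => (s < b)%N)) /=.
by congr (_ + _); apply: eq_bigl => s; lia.
Qed.
End RangeSum.

Section Algorithm.
Context {R : realType} {n : nat}.
Variables (g : 'I_n -> R -> R) (alpha : 'I_n -> R) (beta : 'I_n -> \bar R).
Variables (ybar : 'I_n -> R).
Hypotheses (alpha_ge0 : forall i, 0 <= alpha i)
  (beta_ge0 : forall i, (0 <= beta i)%E)
  (g_lt : forall i x y, box (beta i) x -> box (beta i) y -> x < y ->
     g i x < g i y)
  (ybar_st : forall i, stationary (beta i) (g i) 0 (ybar i))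
  (H_st : forall i x, x <= 0 -> stationary (beta i) (g i) x (H g beta i x)).
Local Notation H := (H g beta).
Local Notation d := (d alpha ybar).
Local Notation w := (w alpha ybar).
Local Notation w_opt := (w_opt alpha ybar).
Local Notation excess := (excess g alpha beta ybar).
Local Notation tail := (tail alpha ybar).

Lemma H_at0 i : H i 0 = ybar i.
Proof. by apply: (stationary_uniq (@g_lt i)) (H_st i (lexx 0)) (ybar_st i). Qed.

Lemma H_le i x y : x <= y -> y <= 0 -> H i x <= H i y.
Proof.
move=> xy y0.
exact: (stationary_le (@g_lt i)) (H_st i (le_trans xy y0)) (H_st i y0) xy.
Qed.

Lemma excess_le a b x y : x <= y -> y <= 0 -> excess a b x <= excess a b y.
Proof. by move=> xy y0; apply: ler_sum => s _; rewrite lerD2r H_le. Qed.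

(** When the price x - M is high enough, every variable responds with 0 and the
    excess is minus a sum of the alpha_s; the intermediate value theorem applies
    between M and x. *)
Lemma excess_root a b x : x <= 0 -> 0 <= excess a b x ->
  exists2 xi, 0 <= xi & excess a b (x - xi) = 0.
Proof.
move=> x0 ex0.
pose u t := \sum_(s < n | (w a <= s < w b)%N) (H s (Num.min t 0) - alpha s).
have uE t : t <= 0 -> u t = excess a b t.
  by move=> t0; apply: eq_bigr => s _; rewrite min_l.
have cu : continuous u.
  apply: continuous_big => // [|s _].
    exact: add_continuous.
  have cH := response_continuous (@g_lt s) (@H_st s).
  by move=> t; exact: cvgB (cH t) (cvg_cst (alpha s)).
pose M := x - \sum_(s < n) `|g s 0|.
have Mx : M <= x by rewrite gerDl oppr_le0 sumr_ge0.
have uM : u M <= 0.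
  rewrite uE ?(le_trans Mx) // /Defs.excess; apply: sumr_le0 => s _.
  have -> : H s M = 0.
    apply: (stationary_uniq (@g_lt s)) (H_st s (le_trans Mx x0)) _.
    apply: stationary_origin => //.
    have := ler_norm (- g s 0); rewrite normrN.
    rewrite /M (bigD1 s) //=.
    have : 0 <= \sum_(i < n | i != s) `|g i 0| by apply: sumr_ge0.
    by lra.
  by rewrite sub0r oppr_le0.
have [||t /[!in_itv]/= /andP[Mt tx] ut] := @IVT R u M x 0 Mx.
- exact: continuous_subspaceT.
- by rewrite ge_min uM le_max uE // ex0 orbT.
exists (x - t); first by rewrite subr_ge0.
by rewrite subKr -uE // (le_trans tx).
Qed.

Lemma d_sum k : d k = \sum_(s < n | (0 <= s < k)%N) (ybar s - alpha s).
Proof. by rewrite sumrB. Qed.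

Section Invariant.
Variable L : nat.
Hypothesis isL : is_L alpha ybar L.
Let e t x := excess t.-1 t x.
Local Notation kkt := (kkt e L).

Lemma e_homo t x y : (0 < t <= L)%N -> x <= y -> y <= 0 -> e t x <= e t y.
Proof. by move=> _; apply: excess_le. Qed.

Lemma flat_excess a b x : (a <= b <= L)%N -> flat e a b x = excess a b x.
Proof.
move=> /andP[/subnKC <-]; elim: (b - a)%N => [|k IH].
  by move=> _; rewrite addn0 /flat big_geq // /Defs.excess big_pred0 // => s; lia.
rewrite addnS => akL; rewrite /flat big_nat_recr /=; last by lia.
rewrite -[X in X + _]/(flat e a (a + k) x) IH 1?ltnW // /e /= /Defs.excess.
rewrite [RHS](@range_sum_cat _ _ _ _ (w (a + k))) //.
by rewrite !(w_mono isL) //; lia.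
Qed.

(** Responding to price 0, the blocks after the a-th one have excess
    d (w L) - d (w a). *)
Lemma excess_total a : (a <= L)%N -> 0 <= excess a L 0.
Proof.
move=> aL; rewrite /Defs.excess; under eq_bigr do rewrite H_at0.
have := d_mono isL aL (leqnn L).
rewrite !d_sum (@range_sum_cat _ _ _ 0 (w a) (w L)) ?lerDl //=.
exact: (w_mono isL).
Qed.

(** The pool j, ..., L always qualifies, since no multiplier lies beyond L; so
    the branch of the algorithm in which there is no r* is never taken. *)
Lemma pool_exists lam j : (0 < j <= L)%N -> exists r,
  [/\ (j <= r <= L)%N, 0 <= excess j.-1 r (- tail L lam r)
    & forall r', (j <= r' < r)%N -> excess j.-1 r' (- tail L lam r') < 0].
Proof.
move=> jL.
have ex0 : exists r, (j <= r <= L)%N && (0 <= excess j.-1 r (- tail L lam r)).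
  exists L; rewrite /Defs.tail big_geq // oppr0 excess_total ?andbT; lia.
case: (ex_minnP ex0) => r /andP[jr er] rmin; exists r; split=> // r' r'r.
by rewrite ltNge; apply/negP => er'; have := rmin r'; rewrite er'; lia.
Qed.

Lemma kkt_pool lam lam' j r xi : (0 < j <= L)%N ->
    kkt (lam \o w) j -> (j <= r <= L)%N ->
    0 <= excess j.-1 r (- tail L lam r) ->
    (forall r', (j <= r' < r)%N -> excess j.-1 r' (- tail L lam r') < 0) ->
    0 <= xi -> excess j.-1 r (- tail L lam r - xi) = 0 ->
    (forall t, (r < t <= L)%N -> lam' (w t) = lam (w t)) -> lam' (w r) = xi ->
    (forall t, (j <= t < r)%N -> lam' (w t) = 0) ->
  kkt (lam' \o w) j.-1.
Proof.
move=> jL K jr er rmin xi0 exi l'l l'r l'0.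
apply: (kkt_step (r := r) (xi := xi) e_homo K) => //.
- lia.
- lia.
- by rewrite flat_excess //; lia.
- by move=> r' r'r; rewrite flat_excess; [exact: rmin|lia].
- by rewrite flat_excess //; lia.
Qed.

Lemma iteration_exists lam j : (0 < j <= L)%N -> kkt (lam \o w) j ->
  exists lam', outer_iteration g alpha beta ybar L lam j lam'.
Proof.
move=> jL K.
have tail0 r : (j <= r)%N -> - tail L lam r <= 0.
  by move=> jr; rewrite oppr_le0; apply: suffix_ge0 K jr.
have [r [jr er rmin]] := pool_exists lam jL.
have [|xi xi0 exi] := excess_root _ er; first by apply: tail0; lia.
have [rj|nrj] := eqVneq r j.
  by rewrite rj in er exi; exists (set_at lam (w j) xi); exact: Case1.
exists (reset alpha ybar (set_at lam (w r) xi) j r); apply: Case2_some => //.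
- by apply: rmin; lia.
- by split=> //; lia.
- move=> r' [jr' er']; rewrite leqNgt; apply/negP => r'r.
  by have := rmin r'; rewrite ltNge er'; lia.
Qed.

Lemma iteration_kkt lam j lam' : (0 < j <= L)%N -> kkt (lam \o w) j ->
    (forall k, (forall t, (0 < t <= L)%N -> k != w t) -> lam k = 0) ->
    (forall k, 0 <= lam k) ->
    outer_iteration g alpha beta ybar L lam j lam' ->
  [/\ kkt (lam' \o w) j.-1,
      forall k, (forall t, (0 < t <= L)%N -> k != w t) -> lam' k = 0
    & forall k, 0 <= lam' k].
Proof.
move=> jL K supp lam0.
have wE i t : (i <= L)%N -> (t <= L)%N -> (w i == w t) = (i == t).
  by move=> iL tL; apply/eqP/eqP => [|->//]; apply: (w_inj isL).
case=> [xi e0 xi0 exi|neg none|r xi neg [jr er] rmin xi0 exi].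
- split.
  + apply: (@kkt_pool lam _ j j xi) => //; try lia.
    * by move=> t tL; rewrite /set_at wE ?gtn_eqF //; lia.
    * by rewrite /set_at eqxx.
  + by move=> k kw; rewrite /set_at (negPf (kw j jL)) supp.
  + by move=> k; rewrite /set_at; case: ifP.
- have [r [jr er rmin]] := pool_exists lam jL.
  have [rj|nrj] := eqVneq r j; first by move: er; rewrite rj leNgt neg.
  by case: (none r); split=> //; lia.
- have inr t : (t <= L)%N ->
      (w t \in [seq w r | r <- index_iota j r]) = (j <= t < r)%N.
    move=> tL; apply/mapP/idP => [[t' + wt]|tjr]; last first.
      by exists t; rewrite ?mem_index_iota.
    rewrite mem_index_iota => t'r.
    by rewrite (w_inj isL tL _ wt) //; lia.
  split.
  + apply: (@kkt_pool lam _ j r xi) => //; try lia.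
    * move=> r' /andP[]; rewrite leq_eqVlt => /orP[/eqP <-//|jr' r'r].
      rewrite ltNge; apply/negP => er'; have := rmin r'; rewrite leqNgt r'r.
      by move=> h; suff : false by []; apply: h; split=> //; lia.
    * move=> t rt; rewrite /reset inr ?ifF /set_at ?wE ?gtn_eqF //; lia.
    * by rewrite /reset inr ?ltnn ?andbF /set_at ?eqxx //; lia.
    * by move=> t tr; rewrite /reset inr ?tr //; lia.
  + move=> k kw; rewrite /reset; case: ifP => // _.
    by rewrite /set_at (negPf (kw r _)) ?supp //; lia.
  + by move=> k; rewrite /reset /set_at; case: ifP => // _; case: ifP.
Qed.

Lemma exec_loop_invariant m lam j :
    exec g alpha beta ybar L m (Loop lam j) ->
  [/\ (m + j = L)%N, kkt (lam \o w) j,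
      forall k, (forall t, (0 < t <= L)%N -> k != w t) -> lam k = 0
    & forall k, 0 <= lam k].
Proof.
move Ec : (Loop lam j) => c ex.
elim: ex lam j Ec =>
  {m c} [//|_ lam j [-> ->]|m lam j lam' _ IH j0 it _ _ [-> ->]|//].
  split=> //; split=> [r|r rL|r]; try by lia.
  by rewrite /cumul big_geq //; lia.
have [mj K supp lam0] := IH _ _ erefl.
have [] := iteration_kkt _ K supp lam0 it; first by lia.
by split=> //; lia.
Qed.

Section Output.
Variable lam : nat -> R.
Hypotheses (K : kkt (lam \o w) 0)
  (supp : forall k, (forall t, (0 < t <= L)%N -> k != w t) -> lam k = 0)
  (lam0 : forall k, 0 <= lam k).

(** The multipliers vanish outside the records, so the price of a variable
    depends only on the last record r up to it. *)
Lemma sum_support p r : (r <= L)%N -> (w r <= p)%N ->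
    (forall t, (r < t <= L)%N -> (p < w t)%N) ->
  \sum_(p.+1 <= k < n.+1) lam k = tail L lam r.
Proof.
move=> rL; have [m mE] : exists m, (m = L - r)%N by exists (L - r)%N.
elim: m r p mE rL => [|m IH] r p mE rL wrp pw.
  have -> : r = L by lia.
  rewrite /Defs.tail [RHS]big_geq // big_nat_cond big1 // => k /andP[pk _].
  apply: supp => t tL; have := w_mono isL (i := t) (j := r); lia.
have pq : (p < w r.+1)%N by apply: pw; lia.
have qn : (w r.+1 <= n)%N by apply: (w_bound isL); lia.
rewrite (@big_cat_nat _ _ _ (w r.+1)) //=; last by lia.
rewrite big_nat_cond big1 ?add0r; last first.
  move=> k /andP[pk _]; apply: supp => t tL.
  have [tr|rt] := leqP t r.
    by have := w_mono isL tr rL; lia.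
  by have := w_mono isL rt; lia.
rewrite big_ltn ?ltnS // (IH r.+1) //; try lia.
  by rewrite /Defs.tail [RHS]big_ltn //; lia.
by move=> t tr; apply: (w_smono isL); lia.
Qed.

Let y i := H i (- multiplier lam i).

Lemma block_sum r k : (r <= L)%N -> (w r <= k <= n)%N ->
    (forall t, (r < t <= L)%N -> (k <= w t)%N) ->
  \sum_(s < n | (w r <= s < k)%N) (y s - alpha s) =
  \sum_(s < n | (w r <= s < k)%N) (H s (- tail L lam r) - alpha s).
Proof.
move=> rL rk kw; apply: eq_bigr => s srk.
rewrite /y /multiplier (sum_support (r := r)) //; first by lia.
by move=> t /kw; lia.
Qed.

Lemma prefix_sum_record r : (r <= L)%N ->
  \sum_(s < n | (s < w r)%N) (y s - alpha s) =
  cumul e L (lam \o w) 0 r.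
Proof.
elim: r => [|r IH] rL.
  by rewrite /cumul big_geq // big_pred0 // => s; rewrite ltn0.
rewrite /cumul big_nat_recr //= -[X in X + _]/(cumul e L (lam \o w) 0 r).
have wr := w_lt isL rL.
rewrite -(IH (ltnW rL)) (@range_sum_cat _ _ _ 0 (w r)) /=; last exact: ltnW.
congr (_ + _); rewrite (block_sum (ltnW rL)) //.
  by rewrite (ltnW wr) (w_bound isL).
by move=> t rt; apply: (w_mono isL); lia.
Qed.

(** After the last record w r the variables consume no more than their
    unconstrained optima, so the prefix sum grows by at most
    d k - d (w r) <= 0. *)
Lemma prefix_sum_le0 k : (k <= n)%N ->
  \sum_(s < n | (s < k)%N) (y s - alpha s) <= 0.
Proof.
move=> kn; have [r [rL rk dk kr]] := last_record_before isL kn.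
rewrite (@range_sum_cat _ _ _ 0 (w r)) //= prefix_sum_record //.
have := kkt_le0 K (r := r); rewrite leq0n rL => /(_ isT).
rewrite block_sum //; [|by rewrite rk|by move=> t /kr; lia].
have : \sum_(s < n | (w r <= s < k)%N) (H s (- tail L lam r) - alpha s) <=
       \sum_(s < n | (w r <= s < k)%N) (ybar s - alpha s).
  apply: ler_sum => s _; rewrite lerD2r -H_at0; apply: H_le => //.
  by rewrite oppr_le0; apply: suffix_ge0 K _.
move: dk; rewrite !d_sum (@range_sum_cat _ _ _ 0 (w r)) //=; lra.
Qed.

Variable f : 'I_n -> R -> R.
Hypotheses (f'E : forall i, is_derivative_on (box (beta i)) (f i) (g i))
  (f_convex : forall i, strictly_convex_on (box (beta i)) (f i)).

Lemma output_optimal : optimal f alpha beta y.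
Proof.
have yst i : stationary (beta i) (g i) (- multiplier lam i) (y i).
  by apply: H_st; rewrite oppr_le0 sumr_ge0.
apply: (multipliers_optimal f'E f_convex (lam := lam)) => //.
  split=> [k /andP[_ kn]|i]; last by case: (yst i).
  by rewrite -subr_le0 -sumrB prefix_sum_le0.
move=> k kn lk.
have [/existsP[t /eqP kt]|] := boolP [exists t : 'I_L, k == w t.+1].
  apply/eqP; rewrite -subr_eq0 -sumrB kt prefix_sum_record //.
  by rewrite (kkt_eq0 K) //= -?kt //; have := ltn_ord t; lia.
rewrite negb_exists => /forallP nk.
move: lk; rewrite supp ?ltxx // => -[|t] // tL.
by have := nk (Ordinal (tL : (t < L)%N)).
Qed.
End Output.
End Invariant.
End Algorithm.

(* The conclusion says: the index L exists and L <= n; no execution performs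
   more than L outer iterations; no execution gets stuck in the while loop (the
   xi required by the algorithm always exist); every output is optimal. *)
Theorem theorem1 (R : realType) (n : nat)
    (f g : 'I_n -> R -> R) (alpha : 'I_n -> R) (beta : 'I_n -> \bar R)
    (ybar : 'I_n -> R)
    (hn : (1 <= n)%N)
    (halpha : forall i, 0 <= alpha i)
    (hbeta : forall i, (0 <= beta i)%E)
    (hderiv : forall i, is_derivative_on (box (beta i)) (f i) (g i))
    (hcont : forall i, {within box (beta i), continuous (g i)})
    (hconvex : forall i, strictly_convex_on (box (beta i)) (f i))
    (hybar : forall i, is_argmin_on (box (beta i)) (f i) (ybar i)) :
  exists L : nat,
    [/\ is_L alpha ybar L /\ (L <= n)%N,
        forall m c, exec g alpha beta ybar L m c -> (m <= L)%N,
        forall m lam j, exec g alpha beta ybar L m (Loop lam j) ->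
          (0 < j)%N ->
          exists lam', outer_iteration g alpha beta ybar L lam j lam' &
        forall m o, exec g alpha beta ybar L m (Done o) ->
          optimal f alpha beta (out_y o)].
Proof.
have g_lt i x y : box (beta i) x -> box (beta i) y -> x < y -> g i x < g i y.
  exact: (derivative_lt (@hderiv i) (@hconvex i)).
have ybar_st i : stationary (beta i) (g i) 0 (ybar i).
  exact: (argmin_stationary (@hderiv i) (hybar i)).
have H_st i x : x <= 0 -> stationary (beta i) (g i) x (H g beta i x).
  exact: (H_stationary (hbeta i) (@hcont i) (@g_lt i) (ybar_st i)).
have [L isL Ln] := last_record alpha ybar.
have inv := exec_loop_invariant g_lt ybar_st H_st isL.
exists L; split=> //.
- move=> m [lam j|o] ex.
    by have [<- _ _ _] := inv _ _ _ ex; lia.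
  inversion ex as [| | |m' lam ex']; subst => //.
  by have [<- _ _ _] := inv _ _ _ ex'; lia.
- move=> m lam j ex j0; have [mj K _ _] := inv _ _ _ ex.
  by apply: (iteration_exists halpha hbeta g_lt ybar_st H_st isL _ K); lia.
- move=> m o ex; inversion ex as [w1| | |m' lam ex']; subst.
    have dneg := @next_record_none _ _ alpha ybar 0.
    split=> [|z [_ zbox]] /=; last first.
      by apply: ler_sum => i _; case: (hybar i) => _; apply.
    split=> [k kn|i]; last by case: (hybar i).
    rewrite -subr_le0 -[leLHS]/(d alpha ybar k) -(d0 alpha ybar) ltW //.
    by apply: dneg; rewrite // -[LHS]/(obind _ (w_opt alpha ybar 0)) -w_optS.
  have [_ K supp lam0] := inv _ _ _ ex'.
  exact: (output_optimal g_lt ybar_st H_st isL K supp lam0 hderiv hconvex).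
Qed.
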